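(* For every positive integer $r$, $\mathrm{ex}(n,\mathcal{C}[r])=O\left(n^{2-1/r}(\log n)^{7/r}\right)$; that is, there is $c=c(r)$ such that every $n$-vertex graph with more than $cn^{2-1/r}(\log n)^{7/r}$ edges contains $C_{2k}[r]$ as a subgraph for some $k\geq 2$.
   Context: For a graph $F$, the $r$-blowup $F[r]$ is obtained by replacing each vertex of $F$ by an independent set of size $r$ and each edge of $F$ by a complete bipartite graph $K_{r,r}$ between the corresponding sets. $\mathcal{C}[r]=\{C_{2k}[r]:k\geq 2\}$. For a family $\mathcal{H}$, $\mathrm{ex}(n,\mathcal{H})$ is the maximum number of edges in an $n$-vertex graph containing no member of $\mathcal{H}$ as a subgraph. Logarithms are base $2$. *)

(* Defs.v *)
From Stdlib Require Import Reals.
From mathcomp Require Import all_boot.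
Set Implicit Arguments. Unset Strict Implicit. Unset Printing Implicit Defensive.

(* A simple graph on a finite vertex type T is a symmetric irreflexive
   relation e : rel T. *)

Definition edge_count (T : finType) (e : rel T) : nat :=
  #|[set A : {set T} | [exists x, exists y, (A == [set x; y]) && e x y]]|.

Definition cycle_blowup_adj (k r : nat) : rel ('I_(2 * k) * 'I_r) :=
  fun u v => ((u.1.+1 %% (2 * k) == v.1) || (v.1.+1 %% (2 * k) == u.1))%N.

Definition contains_cycle_blowup (T : finType) (e : rel T) (k r : nat) : Prop :=
  exists f : 'I_(2 * k) * 'I_r -> T,
    injective f /\ forall u v, @cycle_blowup_adj k r u v -> e (f u) (f v).

Definition log2 (x : R) : R := Rdiv (ln x) (ln (INR 2)).

(* Main.v *)
Require Import Defs.
From Stdlib Require Import Reals.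
From mathcomp Require Import all_boot.
From mathcomp Require Import all_order all_algebra ring lra zify.
Set Implicit Arguments. Unset Strict Implicit. Unset Printing Implicit Defensive.
Import Order.TTheory GRing.Theory Num.Theory.

(** Consider the graph whose vertices are the r-tuples of vertices of G, two
tuples being adjacent when all pairs of entries are: a closed walk of length 2k
through injective, pairwise disjoint tuples is a copy of C_2k[r].  A tuple X
with d common neighbours has degree d^r, and of its neighbours only a fraction
O(r^2/d) is not injective or meets a given tuple.  By convexity the average
degree is at least Q^r with Q of order (log n)^7, and after passing to a dense
core every tuple has d of order at least Q.

It remains to find a closed walk without conflicts.  Weight walks by the inverse
degrees, and let phi(k) be the total weight of closed walks of length 2k, which
is the trace of the 2k-th power of the random walk operator.  Since
1 <= phi(k) <= N = n^r for all k >= 1, there is some k = O(log N) with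
phi(k-1) <= 2 phi(k).  For this k, Cauchy-Schwarz bounds the weight of closed
walks in which the first vertex conflicts with one of the next k by
sqrt(k eps phi(k) phi(k-1)), where eps is the fraction of conflicting
neighbours.  Summing over the 2k rotations, less than the total weight is lost
as soon as eps is a small multiple of k^-3. *)

(** * Closed walks without conflicts *)

Lemma sum_bool_card (V : finType) (p : pred V) :
  \sum_x (p x : nat) = #|[set x | p x]|.
Proof. by rewrite -sum1dep_card [RHS]big_mkcond; apply: eq_bigr => x _; case: (p x). Qed.

(** * Sums over sequences of fixed length *)

Section SeqSums.
Local Open Scope ring_scope.
Variables (F : realFieldType) (V : finType).
Implicit Types (f g : seq V -> F).

Fixpoint seqsum (m : nat) f : F :=
  if m is m'.+1 then \sum_x seqsum m' (fun s => f (x :: s)) else f [::].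

Lemma eq_seqsum m f g :
  (forall s, size s = m -> f s = g s) -> seqsum m f = seqsum m g.
Proof.
elim: m f g => [|m IH] f g fg /=; first exact: fg.
by apply: eq_bigr => x _; apply: IH => s sz; apply: fg; rewrite /= sz.
Qed.

Lemma le_seqsum m f g :
  (forall s, size s = m -> f s <= g s) -> seqsum m f <= seqsum m g.
Proof.
elim: m f g => [|m IH] f g fg /=; first exact: fg.
by apply: ler_sum => x _; apply: IH => s sz; apply: fg; rewrite /= sz.
Qed.

Lemma seqsum_ge0 m f : (forall s, 0 <= f s) -> 0 <= seqsum m f.
Proof. by elim: m f => //= m IH f f_ge0; apply: sumr_ge0 => x _; apply: IH. Qed.

Lemma seqsum_cat m n f :
  seqsum (m + n) f = seqsum m (fun s => seqsum n (fun t => f (s ++ t))).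
Proof. by elim: m f => //= m IH f; apply: eq_bigr => x _; rewrite IH. Qed.

Lemma seqsumD m f g : seqsum m (fun s => f s + g s) = seqsum m f + seqsum m g.
Proof.
elim: m f g => //= m IH f g; rewrite -big_split; apply: eq_bigr => x _.
exact: IH.
Qed.

Lemma seqsum_sum (I : finType) (P : pred I) m (h : I -> seq V -> F) :
  seqsum m (fun s => \sum_(i | P i) h i s) = \sum_(i | P i) seqsum m (h i).
Proof.
elim: m h => //= m IH h; rewrite exchange_big; apply: eq_bigr => x _.
exact: IH.
Qed.

Lemma exchange_seqsum m n (h : seq V -> seq V -> F) :
  seqsum m (fun s => seqsum n (h s)) = seqsum n (fun t => seqsum m (h^~ t)).
Proof.
elim: m h => //= m IH h; rewrite seqsum_sum; apply: eq_bigr => x _.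
exact: IH.
Qed.

Lemma seqsum_mulr m (b : F) f : seqsum m (fun s => b * f s) = b * seqsum m f.
Proof.
by elim: m f => //= m IH f; rewrite mulr_sumr; apply: eq_bigr => x _; rewrite IH.
Qed.

(** Splitting the sum at [n] turns the rotation into an exchange of two blocks. *)
Lemma seqsum_rot n m f : (n <= m)%N -> seqsum m (fun s => f (rot n s)) = seqsum m f.
Proof.
move=> le_nm; rewrite -{1}(subnKC le_nm) seqsum_cat.
transitivity (seqsum n (fun s => seqsum (m - n) (fun t => f (t ++ s)))).
  by apply: eq_seqsum => s sz; apply: eq_seqsum => t _; rewrite -sz rot_size_cat.
by rewrite exchange_seqsum -seqsum_cat subnK.
Qed.

Lemma seqsum_gt0 m f : 0 < seqsum m f -> exists2 s, size s = m & 0 < f s.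
Proof.
elim: m f => [|m IH] f /=; first by exists [::].
move=> h; have [x hx|] := pickP (fun x => 0 < seqsum m (fun s => f (x :: s))).
  by have [s sz fs] := IH _ hx; exists (x :: s); rewrite //= sz.
move=> none; suff: (0 : F) < 0 by rewrite ltxx.
apply: (lt_le_trans h); by apply: sumr_le0 => x _; rewrite leNgt none.
Qed.

End SeqSums.

(** * Energies of the weighted random walk *)

Section ConflictFreeCycle.
Local Open Scope ring_scope.
Variables (F : realFieldType) (V : finType) (a con : rel V).
Hypothesis a_sym : symmetric a.

Definition degree (x : V) : nat := #|[set y | a x y]|.
Let A x y : F := (a x y)%:R.
(** As [0^-1 = 0], isolated vertices have weight zero. *)
Let w x : F := (degree x)%:R^-1.

Let A_ge0 x y : 0 <= A x y. Proof. exact: ler0n. Qed.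
Let A_sym x y : A x y = A y x. Proof. by rewrite /A a_sym. Qed.
Let w_ge0 x : 0 <= w x. Proof. by rewrite invr_ge0 ler0n. Qed.

Let sumA x : \sum_y A x y = (degree x)%:R.
Proof. by rewrite /A -natr_sum sum_bool_card. Qed.

Let degree_gt0 x y : a x y -> (0 < degree x)%N.
Proof. by move=> axy; rewrite /degree card_gt0; apply/set0Pn; exists y; rewrite inE. Qed.

Let w_degree_le1 x : w x * (degree x)%:R <= 1.
Proof.
rewrite /w; case: (degree x) => [|d]; first by rewrite mulr0 ler01.
by rewrite mulVf ?pnatr_eq0.
Qed.

Let w_le1 x : w x <= 1.
Proof.
rewrite /w; case: (degree x) => [|d]; first by rewrite invr0 ler01.
by rewrite invf_le1 ?ltr0n // ler1n.
Qed.

Let A_w_degree x y : A x y * w y * (degree y)%:R = A x y.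
Proof.
rewrite /A; case: (boolP (a x y)) => [axy|_]; last by rewrite !mul0r.
rewrite mul1r mulVf // pnatr_eq0 -lt0n.
by apply: (@degree_gt0 _ x); rewrite a_sym.
Qed.

(* The vertex weights are those of the interior vertices [s] only, so that
   concatenating walks multiplies weights up to the weight of the joint. *)
Fixpoint walk_weight x (s : seq V) z : F :=
  if s is y :: s' then A x y * w y * walk_weight y s' z else A x z.

(** Here [m] counts interior vertices, so these walks have [m.+1] steps, and [energy m] is phi(m+1)
    of the overview, each closed walk being cut at [x] and at the opposite vertex [z]. *)
Definition walks m x z : F := seqsum m (fun s => walk_weight x s z).
Definition energy m : F := \sum_x \sum_z w x * w z * walks m x z ^+ 2.

Lemma walk_weight_ge0 x s z : 0 <= walk_weight x s z.
Proof. by elim: s x => [|y s IH] x /=; rewrite ?mulr_ge0. Qed.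

Lemma walk_weight_cat x s y t z :
  walk_weight x (s ++ y :: t) z = walk_weight x s y * w y * walk_weight y t z.
Proof. by elim: s x => //= u s IH x; rewrite IH !mulrA. Qed.

Lemma walks_ge0 m x z : 0 <= walks m x z.
Proof. by apply: seqsum_ge0 => s; apply: walk_weight_ge0. Qed.

Lemma walksS m x z : walks m.+1 x z = \sum_y A x y * w y * walks m y z.
Proof. by apply: eq_bigr => y _; rewrite -seqsum_mulr. Qed.

Lemma walksSr m x z : walks m.+1 x z = \sum_y A y z * w y * walks m x y.
Proof.
elim: m x z => [|m IH] x z.
  by rewrite walksS; apply: eq_bigr => y _; rewrite /walks /=; ring.
rewrite walksS; under eq_bigr => y _ do rewrite IH mulr_sumr.
rewrite exchange_big; apply: eq_bigr => u _ /=.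
by rewrite walksS mulr_sumr; apply: eq_bigr => y _; ring.
Qed.

Lemma walks_sym m x z : walks m x z = walks m z x.
Proof.
elim: m x z => [|m IH] x z; first by rewrite /walks /= A_sym.
by rewrite walksS walksSr; apply: eq_bigr => y _; rewrite IH A_sym.
Qed.

(** The steps out of [y] have total weight [w y * degree y], which is 1 at every vertex that a walk
    reaches, so lengthening the walks keeps their total. *)
Lemma sum_walks m x : \sum_z walks m x z = (degree x)%:R.
Proof.
elim: m x => [|m IH] x; first exact: sumA.
under eq_bigr => z _ do rewrite walksS.
rewrite exchange_big -sumA; apply: eq_bigr => y _ /=.
by rewrite -mulr_sumr IH A_w_degree.
Qed.

Lemma walks_eq0 m x z : degree x = 0%N -> walks m x z = 0.
Proof.
move=> d0; apply/eqP; rewrite eq_le walks_ge0 andbT.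
have <- : \sum_z walks m x z = 0 by rewrite sum_walks d0.
by rewrite (bigD1 z) //= lerDl sumr_ge0 // => u _; apply: walks_ge0.
Qed.

(** Each edge contributes [w x * w z] with [w z <= 1], and [w x] summed over the neighbours of [x]
    is at most 1. *)
Lemma energy0_le : energy 0 <= #|V|%:R.
Proof.
rewrite -sum1_card natr_sum; apply: ler_sum => x _.
apply: le_trans (w_degree_le1 x); rewrite -sumA mulr_sumr; apply: ler_sum => z _.
rewrite /walks /= /A; case: (a x z); last by rewrite expr0n !mulr0.
by rewrite expr1n !mulr1 ler_piMr.
Qed.

(* Cauchy-Schwarz against the stationary distribution [degree x / vol], in
   the form of a completed square. *)
Lemma energy_ge1 m : (exists x y, a x y) -> 1 <= energy m.
Proof.
move=> [x0 [y0 axy]].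
pose vol : F := \sum_x (degree x)%:R.
have vol_gt0 : 0 < vol.
  rewrite /vol (bigD1 x0) //= ltr_wpDr ?sumr_ge0 // ltr0n.
  exact: degree_gt0 axy.
have sumW : \sum_x \sum_z walks m x z = vol.
  by apply: eq_bigr => x _; apply: sum_walks.
have sumdd : \sum_x \sum_z ((degree x)%:R * (degree z)%:R : F) = vol ^+ 2.
  by rewrite expr2 mulr_suml; apply: eq_bigr => x _; rewrite mulr_sumr.
have : \sum_x \sum_z (2 * vol^-1 * walks m x z
          - vol^-1 ^+ 2 * ((degree x)%:R * (degree z)%:R)) <= energy m.
  apply: ler_sum => x _; apply: ler_sum => z _.
  (* At degree 0 the weight is no inverse and the square cannot be completed, but both sides
     vanish. *)
  have [dx|dx] := eqVneq (degree x) 0%N.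
    by rewrite walks_eq0 // dx; lra.
  have [dz|dz] := eqVneq (degree z) 0%N.
    by rewrite walks_sym walks_eq0 // dz; lra.
  rewrite /w -subr_ge0.
  set X := (degree x)%:R; set Z := (degree z)%:R; set W := walks _ _ _.
  have X0 : X != 0 by rewrite pnatr_eq0.
  have Z0 : Z != 0 by rewrite pnatr_eq0.
  rewrite [leRHS](_ : _ = X^-1 * Z^-1 * (W - vol^-1 * X * Z) ^+ 2); last first.
    by field; rewrite X0 Z0 gt_eqF.
  by rewrite mulr_ge0 ?sqr_ge0 // mulr_ge0 // invr_ge0 ler0n.
under eq_bigr => x _ do rewrite sumrB -mulr_sumr -mulr_sumr.
rewrite sumrB -mulr_sumr -mulr_sumr sumW sumdd.
rewrite [leLHS](_ : _ = 1) //; field; by rewrite gt_eqF.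
Qed.

(** If the energy more than halved at each of [L] steps, [energy L] would be below
    [#|V| / 2 ^ L <= 1], against [energy_ge1]. *)
Lemma energy_ratio L : (0 < L)%N -> (#|V| <= 2 ^ L)%N -> (exists x y, a x y) ->
  exists2 m, (m < L)%N & energy m <= 2 * energy m.+1.
Proof.
move=> L_gt0 leV ex_a.
have [m hm|none] := pickP (fun m : 'I_L => energy m <= 2 * energy m.+1).
  by exists m.
have decay m : (0 < m <= L)%N -> 2 ^+ m * energy m < energy 0.
  elim: m => // m IH lt_mL.
  have /negbT := none (Ordinal lt_mL); rewrite -ltNge /= => h.
  case: m IH lt_mL h => [|m] IH lt_mL h; first by rewrite expr1.
  apply: le_lt_trans (IH (ltnW lt_mL)).
  by rewrite exprSr -mulrA ler_pM2l ?exprn_gt0 // ltW.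
have := decay L; rewrite L_gt0 leqnn => /(_ isT).
have leV' : #|V|%:R <= 2 ^+ L :> F by rewrite -natrX ler_nat.
rewrite ltNge (le_trans energy0_le) // (le_trans leV') //.
by rewrite ler_peMr ?exprn_ge0 // energy_ge1.
Qed.

(** * Closed walks and their rotations *)

Definition cycle_weight (c : seq V) : F :=
  if c is x :: s then w x * walk_weight x s x else 0.

Lemma cycle_weight_ge0 c : 0 <= cycle_weight c.
Proof. by case: c => //= x s; rewrite mulr_ge0 // walk_weight_ge0. Qed.

Lemma cycle_weight_rot n c : cycle_weight (rot n c) = cycle_weight c.
Proof.
rewrite -{2}(cat_take_drop n c) /rot.
case: (take n c) (drop n c) => [|x s] [|y t] //=; rewrite ?cats0 //.
by rewrite !walk_weight_cat; ring.
Qed.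

Lemma walk_weight_gt0 x s z : 0 < walk_weight x s z -> path a x (rcons s z).
Proof.
elim: s x => [|y s IH] x /=; rewrite {1}/A; case: (a x _) => //=;
  rewrite ?mul0r ?ltxx // mul1r => h.
apply: IH; rewrite lt_def walk_weight_ge0 andbT.
by apply: contraTneq h => ->; rewrite mulr0 ltxx.
Qed.

Lemma cycle_weight_gt0 c : 0 < cycle_weight c -> cycle a c.
Proof.
case: c => //= x s h; apply: walk_weight_gt0.
rewrite lt_def walk_weight_ge0 andbT.
by apply: contraTneq h => ->; rewrite mulr0 ltxx.
Qed.

(** Cut the closed walk at the vertex [z] opposite to [x]. As [h] sees only the half from [x] to
    [z], the other half sums freely to [walks m x z]. *)
Lemma seqsum_cycle_weight m (h : seq V -> F) :
  seqsum (m.+1 + m.+1) (fun c => h (take m.+2 c) * cycle_weight c) =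
  \sum_x \sum_z w x * w z * walks m x z *
    seqsum m (fun s => h (x :: rcons s z) * walk_weight x s z).
Proof.
rewrite addSn /=; apply: eq_bigr => x _.
rewrite seqsum_cat /= seqsum_sum; apply: eq_bigr => z _.
rewrite -seqsum_mulr; apply: eq_seqsum => s sz.
rewrite walks_sym /walks.
transitivity (w x * w z * (h (x :: rcons s z) * walk_weight x s z)
  * seqsum m (fun t => walk_weight z t x)); last by ring.
rewrite -seqsum_mulr; apply: eq_seqsum => t _.
rewrite walk_weight_cat -cat_rcons take_size_cat ?size_rcons ?sz //; ring.
Qed.

Lemma seqsum_cycle_weight1 m : seqsum (m.+1 + m.+1) cycle_weight = energy m.
Proof.
have := seqsum_cycle_weight m (fun _ => 1).
under eq_seqsum => c _ do rewrite mul1r.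
move=> ->; apply: eq_bigr => x _; apply: eq_bigr => z _.
by under eq_seqsum => s _ do rewrite mul1r; rewrite expr2 mulrA.
Qed.

(** Only the first vertex is tested; rotations bring every vertex of a closed walk to the front. *)
Definition conflict_ahead (c : seq V) : bool :=
  if c is x :: s then has (con x) s else false.

(** In the overview's notation [s] is 1/eps. *)
Variable s : nat.
Hypothesis con_le : forall y u, (#|[set x | a y x && con x u]| * s <= degree y)%N.

Lemma conflicts_le y (t : seq V) :
  s%:R * (\sum_x A x y * (has (con x) t)%:R) <= (size t)%:R * (degree y)%:R :> F.
Proof.
elim: t => [|u t IH] /=; first by rewrite big1 ?mulr0 ?mul0r // => x _; rewrite mulr0.
have split_has : \sum_x A x y * (con x u || has (con x) t)%:R <=
   \sum_x (a y x && con x u)%:R + \sum_x A x y * (has (con x) t)%:R.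
  rewrite -big_split; apply: ler_sum => x _; rewrite A_sym /A.
  by case: (a y x) (con x u) (has _ _) => [] [] [] /=; lra.
apply: (le_trans (ler_wpM2l (ler0n _ _) split_has)).
rewrite mulrDr -[(size t).+1]add1n natrD mulrDl mul1r lerD // mulrC.
by rewrite -natr_sum sum_bool_card -natrM ler_nat.
Qed.

(* Closed walks of length [2 * m.+2] whose first vertex [x] conflicts with one
   of the next [m.+2]: with [y] the second vertex and [z] the vertex opposite
   to [x], AM-GM separates the walk count [x .. z], giving the first energy,
   from the count of conflicting walks [y .. z], which is at most [walks m y z]
   and, summed over [x], a small fraction of it. *)
Lemma conflict_weight_le m : (0 < s)%N ->
  seqsum (m.+2 + m.+2)
    (fun c => (conflict_ahead (take m.+3 c))%:R * cycle_weight c) <=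
  energy m.+1 / (4 * m.+2%:R) + m.+2%:R ^+ 2 / s%:R * energy m.
Proof.
move=> s_gt0.
pose C x y z := seqsum m (fun t => (has (con x) (y :: rcons t z))%:R * walk_weight y t z).
(* This makes the coefficient of [energy m.+1] equal to [1 / (4 * m.+2)], which adds up to one half
   over all [2 * m.+2] rotations. *)
pose lam : F := (2 * m.+2%:R)^-1.
have m2_gt0 : (0 : F) < m.+2%:R by rewrite ltr0n.
have s_gt0' : (0 : F) < s%:R by rewrite ltr0n.
have lam_gt0 : 0 < lam by rewrite invr_gt0 mulr_gt0 // ltr0n.
have C_ge0 x y z : 0 <= C x y z.
  by apply: seqsum_ge0 => t; rewrite mulr_ge0 // walk_weight_ge0.
have C_le x y z : C x y z <= walks m y z.
  by apply: le_seqsum => t _; rewrite ler_piMl ?walk_weight_ge0 // lern1 leq_b1.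
have sum_C y z : s%:R * (\sum_x A x y * C x y z) <= m.+2%:R * (degree y)%:R * walks m y z.
  under eq_bigr => x _ do rewrite -seqsum_mulr.
  rewrite -seqsum_sum -!seqsum_mulr; apply: le_seqsum => t sz.
  have -> : m.+2 = size (y :: rcons t z) by rewrite /= size_rcons sz.
  under eq_bigr => x _ do rewrite mulrA.
  by rewrite -mulr_suml mulrA ler_wpM2r ?walk_weight_ge0 // conflicts_le.
(* One factor [C] is bounded by [walks], the other is summed by [sum_C], and one [w y] cancels
   [degree y]. *)
have sum_C2 y z : \sum_x A x y * (w y * C x y z) ^+ 2 <=
    m.+2%:R / s%:R * (w y * walks m y z ^+ 2).
  have : \sum_x A x y * C x y z ^+ 2 <=
      m.+2%:R / s%:R * (degree y)%:R * walks m y z ^+ 2.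
    have h : \sum_x A x y * C x y z ^+ 2 <= (\sum_x A x y * C x y z) * walks m y z.
      rewrite mulr_suml; apply: ler_sum => x _.
      by rewrite -mulrA ler_wpM2l // expr2 ler_wpM2l.
    apply: (le_trans h); rewrite expr2 mulrA ler_wpM2r ?walks_ge0 //.
    rewrite -(ler_pM2l s_gt0') (le_trans (sum_C y z)) // le_eqVlt.
    by apply/orP; left; apply/eqP; field; rewrite gt_eqF.
  move/(ler_wpM2l (sqr_ge0 (w y))); rewrite mulr_sumr.
  under eq_bigr => x _ do rewrite mulrCA -exprMn.
  move=> h; apply: (le_trans h).
  set W := walks m y z ^+ 2.
  have -> : w y ^+ 2 * (m.+2%:R / s%:R * (degree y)%:R * W) =
     (m.+2%:R / s%:R * (w y * W)) * (w y * (degree y)%:R) by ring.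
  rewrite ler_piMr //.
  by rewrite mulr_ge0 ?divr_ge0 ?ler0n // mulr_ge0 ?sqr_ge0.
have amgm (p q : F) : p * q <= lam / 2 * p ^+ 2 + q ^+ 2 / (2 * lam).
  rewrite -subr_ge0.
  have -> : lam / 2 * p ^+ 2 + q ^+ 2 / (2 * lam) - p * q =
    (lam * p - q) ^+ 2 / (2 * lam) by field; rewrite gt_eqF.
  by rewrite mulr_ge0 ?sqr_ge0 // invr_ge0 mulr_ge0 // ltW.
rewrite (seqsum_cycle_weight m.+1 (fun c => (conflict_ahead c)%:R)).
have : \sum_x \sum_z \sum_y w z * A x y *
      (lam / 2 * (w x * walks m.+1 x z) ^+ 2)
    + \sum_x \sum_z \sum_y w z * A x y * ((w y * C x y z) ^+ 2 / (2 * lam)) <=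
    energy m.+1 / (4 * m.+2%:R) + m.+2%:R ^+ 2 / s%:R * energy m.
  have -> : energy m.+1 / (4 * m.+2%:R) + m.+2%:R ^+ 2 / s%:R * energy m =
    lam / 2 * energy m.+1 + m.+2%:R / s%:R / (2 * lam) * energy m.
    rewrite /lam; move: (m.+2%:R : F) m2_gt0 => M M_gt0; by field; rewrite !gt_eqF.
  apply: lerD.
    rewrite mulr_sumr; apply: ler_sum => x _; rewrite mulr_sumr; apply: ler_sum => z _.
    rewrite -mulr_suml -mulr_sumr sumA.
    set W := walks _ _ _.
    have -> : w z * (degree x)%:R * (lam / 2 * (w x * W) ^+ 2) =
      (lam / 2 * (w x * w z * W ^+ 2)) * (w x * (degree x)%:R) by ring.
    rewrite ler_piMr // mulr_ge0 ?divr_ge0 ?(ltW lam_gt0) ?ler0n //.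
    by rewrite mulr_ge0 ?sqr_ge0 // mulr_ge0.
  rewrite exchange_big /=; under eq_bigr => z _ do rewrite exchange_big.
  rewrite exchange_big mulr_sumr; apply: ler_sum => y _ /=.
  rewrite mulr_sumr; apply: ler_sum => z _.
  under eq_bigr => x _ do rewrite -mulrA mulrA mulrA.
  rewrite -mulr_suml.
  under eq_bigr => x _ do rewrite -mulrA.
  rewrite -mulr_sumr.
  have := ler_wpM2l (w_ge0 z) (sum_C2 y z).
  rewrite -(ler_pM2r (_ : 0 < (2 * lam)^-1)) ?invr_gt0 ?mulr_gt0 //.
  move=> h; apply: (le_trans h); rewrite le_eqVlt; apply/orP; left; apply/eqP; ring.
apply: le_trans; rewrite -big_split; apply: ler_sum => x _.
rewrite -big_split; apply: ler_sum => z _ /=; rewrite -big_split mulr_sumr.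
apply: ler_sum => y _; rewrite /= -mulrDr.
have -> : seqsum m (fun t => (conflict_ahead (x :: y :: rcons t z))%:R
     * (A x y * w y * walk_weight y t z)) = A x y * (w y * C x y z).
  by rewrite mulrA /C -seqsum_mulr; apply: eq_seqsum => t _; ring.
rewrite (_ : _ * _ = w z * A x y * ((w x * walks m.+1 x z) * (w y * C x y z))); last by ring.
by rewrite ler_wpM2l // mulr_ge0.
Qed.

Lemma conflict_free_cycle L : (0 < L)%N -> (#|V| <= 2 ^ L)%N ->
  (exists x y, a x y) -> (16 * L.+1 ^ 3 <= s)%N ->
  exists k c, [/\ (2 <= k)%N, size c = (2 * k)%N, cycle a c
    & forall i, (i < 2 * k)%N -> ~~ conflict_ahead (take k.+1 (rot i c))].
Proof.
move=> L_gt0 leV ex_a leLs.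
have [m lt_mL energy_m] := energy_ratio L_gt0 leV ex_a.
set n := (m.+2 + m.+2)%N.
pose bad i (c : seq V) : F := (conflict_ahead (take m.+3 (rot i c)))%:R.
have bad_ge0 i c : 0 <= bad i c by exact: ler0n.
have s_gt0 : (0 < s)%N by apply: leq_trans leLs; rewrite muln_gt0 expn_gt0.
have bound := conflict_weight_le m s_gt0.
set T := seqsum _ _ in bound.
have sum_bad i : (i < n)%N -> seqsum n (fun c => bad i c * cycle_weight c) = T.
  move=> lt_in; rewrite /T -[RHS](seqsum_rot _ (ltnW lt_in)).
  by apply: eq_seqsum => c _; rewrite cycle_weight_rot.
(* The factor [1 - \sum_i bad i c] is at most 0 once a rotation is bad, so a positive sum yields a
   closed walk with no bad rotation. *)
have : 0 < seqsum n (fun c => (1 - \sum_(i < n) bad i c) * cycle_weight c).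
  have -> : seqsum n (fun c => (1 - \sum_(i < n) bad i c) * cycle_weight c)
      = energy m.+1 - n%:R * T.
    rewrite -seqsum_cycle_weight1 mulr_natl -[n in T *+ n]card_ord -sumr_const.
    under [in RHS]eq_bigr => i _ do rewrite -(sum_bad i (ltn_ord i)).
    rewrite -seqsum_sum -[X in _ - X]mul1r -mulNr -seqsum_mulr -seqsumD.
    apply: eq_seqsum => c _; rewrite -mulr_suml; ring.
  have n_eq : n%:R = 2 * m.+2%:R :> F by rewrite /n natrD; ring.
  have e1 := energy_ge1 m.+1 ex_a.
  have : 16 * m.+2%:R ^+ 3 <= s%:R :> F.
    by rewrite -natrX -natrM ler_nat (leq_trans _ leLs) // leq_mul2l leq_exp2r.
  have : (0 : F) < m.+2%:R by rewrite ltr0n.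
  have : (0 : F) < s%:R by rewrite ltr0n.
  rewrite n_eq; move: (m.+2%:R) (s%:R) bound => K S bound S0 K0 leKS.
  rewrite subr_gt0.
  have hK : 0 <= K ^+ 2 / S by rewrite divr_ge0 ?sqr_ge0 ?ltW.
  have h1 := le_trans bound (lerD (lexx _) (ler_wpM2l hK energy_m)).
  (* The total loss is at most 1/2 + 1/4 of the energy, the second share because
     [16 * K ^ 3 <= S]. *)
  have h2 : 2 * K * T <= energy m.+1 / 2 + 4 * K ^+ 3 / S * energy m.+1.
    have -> : energy m.+1 / 2 + 4 * K ^+ 3 / S * energy m.+1 =
      2 * K * (energy m.+1 / (4 * K) + K ^+ 2 / S * (2 * energy m.+1)).
      by field; rewrite !gt_eqF.
    by rewrite ler_wpM2l // mulr_ge0 // ltW.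
  have h3 : 4 * K ^+ 3 / S <= 1 / 4 by rewrite ler_pdivrMr //; lra.
  have h4 := ler_wpM2r (le_trans ler01 e1) h3.
  by apply: (le_lt_trans h2); lra.
move=> /seqsum_gt0 [c sz pos].
have cw_gt0 : 0 < cycle_weight c.
  rewrite lt_def cycle_weight_ge0 andbT.
  by apply: contraTneq pos => ->; rewrite mulr0 ltxx.
move: pos; rewrite pmulr_lgt0 // subr_gt0 => lt1.
have n2 : (2 * m.+2 = n)%N by rewrite mul2n -addnn.
exists m.+2, c; split; rewrite ?n2 //; first exact: cycle_weight_gt0.
move=> i lt_in; apply: contraTN lt1 => bad_i; rewrite -leNgt.
rewrite (bigD1 (Ordinal lt_in)) //= {1}/bad bad_i lerDl.
exact: sumr_ge0.
Qed.

End ConflictFreeCycle.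

(** * The graph of tuples *)

(** Induction on the exponent by Chebyshev's sum inequality, which is (x - y)(x^m - y^m) >= 0 summed
    over all pairs. *)
Lemma leq_power_mean (I : finType) (f : I -> nat) r :
  (\sum_i f i) ^ r.+1 <= #|I| ^ r * \sum_i f i ^ r.+1.
Proof.
have chebyshev m : (\sum_i f i) * (\sum_i f i ^ m) <= #|I| * \sum_i f i ^ m.+1.
  rewrite -(leq_pmul2l (isT : 0 < 2)) 2![2 * _]mulSn !mul1n.
  have prodE : (\sum_i f i) * (\sum_i f i ^ m) = \sum_i \sum_j f i * f j ^ m.
    by rewrite big_distrl; apply: eq_bigr => i _; rewrite big_distrr.
  have prodE' : (\sum_i f i) * (\sum_i f i ^ m) = \sum_i \sum_j f j * f i ^ m.
    by rewrite prodE exchange_big.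
  have constE : #|I| * (\sum_i f i ^ m.+1) = \sum_i \sum_(j : I) f i ^ m.+1.
    by rewrite big_distrr; apply: eq_bigr => i _; rewrite sum_nat_const.
  have constE' : #|I| * (\sum_i f i ^ m.+1) = \sum_(i : I) \sum_j f j ^ m.+1.
    by rewrite constE exchange_big.
  rewrite {1}prodE prodE' {1}constE constE' -!big_split.
  apply: leq_sum => i _; rewrite -!big_split; apply: leq_sum => j _ /=.
  have mono x y : x <= y -> x ^ m <= y ^ m.
    by case: (m) => // m' ?; rewrite leq_exp2r.
  rewrite !expnS; have [le_ij|/ltnW le_ji] := leqP (f i) (f j).
    by move: (mono _ _ le_ij); nia.
  by move: (mono _ _ le_ji); nia.
elim: r => [|r IH]; first by rewrite mul1n.
rewrite expnS (leq_trans (leq_mul (leqnn _) IH)) // mulnCA expnSr -mulnA.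
by rewrite leq_mul2l chebyshev orbT.
Qed.

(* Maximize the number of edges inside [U] minus a vertex cost: no vertex of
   an optimal [U] can have small degree inside [U]. *)
Lemma exists_dense_core (V : finType) (a : rel V) :
  symmetric a -> irreflexive a -> 0 < \sum_x degree a x ->
  exists2 U : {set V}, U != set0 &
    forall x, x \in U -> 2 * #|V| * degree a x + \sum_x degree a x <=
      8 * #|V| * #|[set y in U | a x y]|.
Proof.
move=> a_sym a_irr vol_gt0; set vol := \sum_x _ in vol_gt0 *.
pose inner (U : {set V}) x := #|[set y in U | a x y]|.
pose e2 (U : {set V}) := \sum_(x in U) inner U x.
pose cost (U : {set V}) := \sum_(x in U) (2 * #|V| * degree a x + vol).
(* The gain is 0 on the empty set and [#|V| * vol] on the full one, so the empty set is not optimal.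
   Deleting [x] lowers [e2] by twice its inner degree, whence the 8. *)
pose gain U : int := ((4 * #|V| * e2 U)%:Z - (cost U)%:Z)%R.
have sumT (f : V -> nat) : \sum_(x in [set: V]) f x = \sum_x f x.
  by apply: eq_bigl => x; rewrite inE.
have e2T : e2 setT = vol.
  rewrite /e2 /vol sumT; apply: eq_bigr => x _; congr #|pred_of_set _|.
  by apply/setP => y; rewrite !inE.
have costT : cost setT = 3 * #|V| * vol.
  transitivity (2 * #|V| * vol + #|V| * vol); last by nia.
  by rewrite /cost sumT big_split -big_distrr /= sum_nat_const.
have V_gt0 : 0 < #|V|.
  rewrite lt0n; apply: contraTneq vol_gt0 => /card0_eq V0.
  by rewrite /vol big_pred0.
have [U _ maxU] := @arg_maxP _ _ _ setT xpredT gain isT.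
exists U.
  apply/negP => /eqP U0; have := maxU setT isT; rewrite /gain e2T costT U0.
  by rewrite /cost /e2 !big_set0; nia.
move=> x xU; have := maxU (U :\ x) isT; rewrite /gain.
have costE : cost U = 2 * #|V| * degree a x + vol + cost (U :\ x).
  by rewrite /cost (big_setD1 x).
have e2E : e2 U = 2 * inner U x + e2 (U :\ x).
  have innerE y : inner U y = a y x + inner (U :\ x) y.
    rewrite /inner (cardD1 x) !inE xU; congr (_ + _); apply: eq_card => z.
    by rewrite !inE andbA.
  rewrite /e2 (big_setD1 x) //= mul2n -addnn -addnA; congr (_ + _).
  under eq_bigr => y _ do rewrite innerE.
  rewrite big_split /=; congr (_ + _).
  have -> : \sum_(y in U :\ x) (a y x : nat) = \sum_(y | y \in U) (a x y : nat).
    rewrite [RHS](big_setD1 x) //= a_irr; apply: eq_bigr => y _.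
    by rewrite a_sym.
  rewrite /inner -sum1dep_card [RHS]big_mkcondr.
  by apply: eq_bigr => y _; case: (a x y).
rewrite costE e2E -/(inner U x); nia.
Qed.

(** * Degrees and conflicts of tuples *)

Section Blowup.
Variables (T : finType) (e : rel T) (r : nat).
Hypotheses (e_sym : symmetric e) (e_irr : irreflexive e) (r_gt0 : 0 < r).
Local Notation V := {ffun 'I_r -> T}.

Definition complete_pair : rel V := fun X Y => [forall i, forall j, e (X i) (Y j)].

Definition common_nbrs (X : V) : {set T} := [set v | [forall i, e (X i) v]].

(* The first argument is charged for not being injective, so that a
   conflict-free closed walk consists of injective tuples. *)
Definition tuple_conflict : rel V := fun X Y =>
  ~~ injectiveb X || [exists i, exists j, X i == Y j].

Lemma complete_pair_sym : symmetric complete_pair.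
Proof.
by move=> X Y; apply/forallP/forallP => h i; apply/forallP => j;
  rewrite e_sym; move/forallP: (h j).
Qed.

Lemma complete_pair_irr : irreflexive complete_pair.
Proof.
move=> X; apply/negP => /forallP /(_ (Ordinal r_gt0)) /forallP /(_ (Ordinal r_gt0)).
by rewrite e_irr.
Qed.

Lemma complete_pairE X Y : complete_pair X Y = (Y \in ffun_on (common_nbrs X)).
Proof.
apply/forallP/ffun_onP => [h i|h i].
  by rewrite inE; apply/forallP => j; move/forallP: (h j).
by apply/forallP => j; have := h j; rewrite inE => /forallP.
Qed.

Lemma card_ffun_on_ord (A : {set T}) : #|(ffun_on A : {pred V})| = #|A| ^ r.
Proof. by rewrite card_ffun_on card_ord. Qed.

Lemma degree_complete_pair X : degree complete_pair X = #|common_nbrs X| ^ r.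
Proof.
rewrite -card_ffun_on_ord; apply: eq_card => Y.
by rewrite inE complete_pairE.
Qed.

(** Double counting of the pairs of a tuple and a vertex adjacent to all its entries. *)
Lemma sum_card_common_nbrs : \sum_(X : V) #|common_nbrs X| = \sum_v degree e v ^ r.
Proof.
have cardE (X : V) : #|common_nbrs X| = \sum_v ([forall i, e (X i) v] : nat).
  by rewrite sum_bool_card.
rewrite (eq_bigr _ (fun X _ => cardE X)).
rewrite exchange_big; apply: eq_bigr => v _ /=.
rewrite sum_bool_card -card_ffun_on_ord; apply: eq_card => X.
rewrite inE; apply/forallP/ffun_onP => h i; have := h i; by rewrite inE e_sym.
Qed.

(** The power mean inequality is used twice, over the vertices and then over the [#|T| ^ r] tuples.
    The exponent [2 * r - 1] is [r] plus the [r - 1] lost in the first use. *)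
Lemma sum_degree_complete_pair Q : 0 < #|T| ->
  #|T| ^ (2 * r - 1) * Q <= (\sum_v degree e v) ^ r ->
  #|T| ^ r * Q ^ r <= \sum_X degree complete_pair X.
Proof.
move=> n_gt0 hQ; set n := #|T| in n_gt0 hQ *.
have cardV : #|{: V}| = n ^ r by rewrite card_ffun card_ord.
have N_gt0 : 0 < n ^ r by rewrite expn_gt0 n_gt0.
have r1 : r = r.-1.+1 by rewrite prednK.
have h1 : n ^ r * Q <= \sum_(X : V) #|common_nbrs X|.
  rewrite sum_card_common_nbrs -(@leq_pmul2l (n ^ r.-1)) ?expn_gt0 ?n_gt0 //.
  rewrite mulnA -expnD (_ : r.-1 + r = 2 * r - 1); last by lia.
  apply: (leq_trans hQ).
  by have := leq_power_mean (degree e) r.-1; rewrite -r1.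
have h2 : (n ^ r) ^ r.-1 * (n ^ r * Q ^ r) <= (n ^ r) ^ r.-1 *
    \sum_X degree complete_pair X.
  rewrite mulnA -expnSr -r1 -expnMn.
  apply: (leq_trans (_ : _ <= (\sum_(X : V) #|common_nbrs X|) ^ r)).
    by rewrite leq_exp2r.
  have := leq_power_mean (fun X : V => #|common_nbrs X|) r.-1.
  rewrite -r1 cardV => /leq_trans; apply.
  by rewrite leq_mul2l; apply/orP; right; apply: leq_sum => X _; rewrite degree_complete_pair.
by move: h2; rewrite leq_pmul2l // expn_gt0 N_gt0.
Qed.

(** Overwriting entry [i] of a tuple of [S] by an element of [A] loses no information, as the other
    entries determine it. *)
Lemma card_determined (A : {set T}) (i : 'I_r) (S : {set V}) :
  {subset S <= ffun_on A} ->
  {in S &, forall f g : V, (forall j, j != i -> f j = g j) -> f i = g i} ->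
  #|A| * #|S| <= #|A| ^ r.
Proof.
move=> SA det; rewrite -cardsX -card_ffun_on_ord.
pose upd (p : T * V) : V := [ffun j => if j == i then p.1 else p.2 j].
have upd_inj : {in setX A S &, injective upd}.
  move=> [v f] [v' g]; rewrite !inE /= => /andP[_ fS] /andP[_ gS] /ffunP eq_upd.
  have eq_v : v = v' by have := eq_upd i; rewrite !ffunE eqxx.
  have fg j : j != i -> f j = g j.
    by move=> ji; have := eq_upd j; rewrite !ffunE (negPf ji).
  congr (_, _) => //; apply/ffunP => j.
  by have [->|/fg //] := eqVneq j i; apply: det.
rewrite -(card_in_imset upd_inj); apply/subset_leq_card/subsetP => h.
case/imsetP => [[v f]]; rewrite inE /= => /andP[vA fS] ->.
apply/ffun_onP => j; rewrite ffunE /=; case: eqP => // _.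
by have /ffun_onP := SA f fS.
Qed.

(** A union bound over the index pairs and the two events [X i = X j] (with [i != j]) and
    [X i = u j], each of which determines entry [i] from the others. *)
Lemma card_tuple_conflict (A : {set T}) (u : V) :
  #|A| * #|[set X in ffun_on A | tuple_conflict X u]| <= 2 * r ^ 2 * #|A| ^ r.
Proof.
pose S1 i j := [set X : V in ffun_on A | (i != j) && (X i == X j)].
pose S2 i j := [set X : V in ffun_on A | X i == u j].
have sub : [set X in ffun_on A | tuple_conflict X u] \subset
    \bigcup_i \bigcup_j (S1 i j :|: S2 i j).
  apply/subsetP => X; rewrite inE => /andP[XA].
  have hit i j : X \in S1 i j :|: S2 i j -> X \in \bigcup_i \bigcup_j (S1 i j :|: S2 i j).
    by move=> h; apply/bigcupP; exists i => //; apply/bigcupP; exists j.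
  case/orP => [/injectivePn [i [j ij eq_ij]]|/existsP [i /existsP [j eq_ij]]].
    by apply: (hit i j); rewrite in_setU !in_set XA ij eq_ij eqxx.
  by apply: (hit i j); rewrite in_setU !in_set XA eq_ij orbT.
apply: (leq_trans (leq_mul (leqnn _) (subset_leq_card sub))).
have cup (F : 'I_r -> {set V}) : #|\bigcup_i F i| <= \sum_i #|F i|.
  elim/big_ind2: _ => [|x y x' y' h h'|//]; first by rewrite cards0.
  by rewrite (leq_trans (leq_card_setU _ _)) // leq_add.
have -> : 2 * r ^ 2 * #|A| ^ r = \sum_(i < r) \sum_(j < r) 2 * #|A| ^ r.
  by rewrite !sum_nat_const card_ord; ring.
apply: (leq_trans (leq_mul (leqnn _) (cup _))); rewrite big_distrr.
apply: leq_sum => i _ /=.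
apply: (leq_trans (leq_mul (leqnn _) (cup _))); rewrite big_distrr.
apply: leq_sum => j _ /=.
apply: (leq_trans (leq_mul (leqnn _) (leq_card_setU _ _))).
rewrite mulnDr mul2n -addnn leq_add //; apply: (@card_determined _ i).
- by move=> X; rewrite inE => /andP[].
- move=> X Y; rewrite !inE => /and3P[_ ij /eqP ->] /and3P[_ _ /eqP ->]; apply.
  by rewrite eq_sym.
- by move=> X; rewrite inE => /andP[].
- by move=> X Y; rewrite !inE => /andP[_ /eqP ->] /andP[_ /eqP ->].
Qed.

End Blowup.

(** Of two positions on a cycle of length [2 * k], one is at most [k] steps ahead of the other, so
    the rotations test every pair. *)
Lemma conflict_free_blowup (T : finType) (e : rel T) r k (c : seq {ffun 'I_r -> T}) :
  symmetric e -> 2 <= k -> size c = 2 * k -> cycle (complete_pair e (r := r)) c ->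
  (forall i, i < 2 * k ->
    ~~ conflict_ahead (@tuple_conflict T r) (take k.+1 (rot i c))) ->
  contains_cycle_blowup e k r.
Proof.
move=> e_sym k_ge2 sz_c cyc free.
have [X0 _] : exists X0, X0 \in c.
  by case: c sz_c {cyc free} => [|x c] /=; [lia | exists x; rewrite mem_head].
pose X i := nth X0 c i.
have rotE i d : i < 2 * k -> d < 2 * k -> nth X0 (rot i c) d = X ((i + d) %% (2 * k)).
  move=> lt_i lt_d; rewrite /rot nth_cat size_drop sz_c nth_drop.
  case: ltnP => h; first by rewrite modn_small //; lia.
  rewrite nth_take; last by lia.
  have -> : i + d = (d - (2 * k - i)) + 2 * k by lia.
  by rewrite modnDr modn_small //; lia.
have clash i d : i < 2 * k -> 0 < d <= k ->
    ~~ tuple_conflict (X i) (X ((i + d) %% (2 * k))).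
  move=> lt_i /andP[d_gt0 le_dk]; have := free i lt_i.
  have := rotE i 0 lt_i; have := rotE i d lt_i; have := size_rot i c.
  rewrite sz_c; case: (rot i c) => [|x s] /=; first by lia.
  case=> sz_s h1 h2; rewrite -h1; last by lia.
  rewrite addn0 modn_small // in h2; rewrite -h2; last by lia.
  apply: contraNN => hc; apply/hasP; exists (nth X0 (x :: s) d) => //.
  rewrite -(prednK d_gt0) /= -(@nth_take k); last by lia.
  have le_ks : k <= size s by rewrite -ltnS sz_s; lia.
  by apply: mem_nth; rewrite size_takel // prednK.
have adj i : i < 2 * k -> complete_pair e (X i) (X (i.+1 %% (2 * k))).
  move=> lt_i; have := cyc; rewrite -(rot_cycle i).
  have := rotE i 0 lt_i; have := rotE i 1 lt_i; have := size_rot i c.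
  rewrite sz_c; case: (rot i c) => [|x [|y s]] /=; try lia.
  move=> _ h1 h2 /andP[axy _].
  rewrite addn1 in h1; rewrite addn0 modn_small // in h2.
  by rewrite -h1 -1?h2 //; lia.
have X_inj i : i < 2 * k -> injective (X i).
  move=> lt_i; have := @clash i 1 lt_i; rewrite negb_or negbK.
  by case/(_ _)/andP; [lia | move/injectiveP].
have disjoint i j (s t : 'I_r) : i < j < 2 * k -> X i s != X j t.
  move=> /andP[lt_ij lt_j]; apply/eqP => eq_st.
  have [le_k|lt_k] := leqP (j - i) k.
    have := @clash i (j - i) (ltn_trans lt_ij lt_j).
    rewrite subnKC ?(ltnW lt_ij) // modn_small // negb_or => /(_ _)/andP[|_]; first by lia.
    by case/existsP; exists s; apply/existsP; exists t; rewrite eq_st.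
  (* Going on from [j] around the cycle, [i] is reached in fewer than [k] steps. *)
  have := @clash j (2 * k - (j - i)) lt_j.
  have -> : (j + (2 * k - (j - i))) %% (2 * k) = i.
    have -> : j + (2 * k - (j - i)) = i + 2 * k by lia.
    by rewrite modnDr modn_small //; lia.
  rewrite negb_or => /(_ _)/andP[|_]; first by lia.
  by case/existsP; exists t; apply/existsP; exists s; rewrite eq_st.
exists (fun p : 'I_(2 * k) * 'I_r => X p.1 p.2); split.
  move=> [i s] [j t] /= eq_X; case: (ltngtP i j) => [lt_ij|lt_ji|/ord_inj eq_ij].
  - by have := @disjoint i j s t; rewrite lt_ij ltn_ord eq_X eqxx => /(_ isT).
  - by have := @disjoint j i t s; rewrite lt_ji ltn_ord eq_X eqxx => /(_ isT).
  - by rewrite eq_ij in eq_X *; rewrite (X_inj _ (ltn_ord j) _ _ eq_X).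
move=> [i s] [j t] /orP[] /= /eqP eq_ij.
  by have := adj i (ltn_ord i); rewrite eq_ij => /forallP /(_ s) /forallP.
rewrite e_sym.
by have := adj j (ltn_ord j); rewrite eq_ij => /forallP /(_ t) /forallP.
Qed.

Lemma cycle_blowup_of_degree_sum (T : finType) (e : rel T) r l :
  symmetric e -> irreflexive e -> 0 < r -> 0 < l -> 0 < #|T| <= 2 ^ l ->
  #|T| ^ (2 * r - 1) * (6 * (1024 * r ^ 5 * l ^ 3)) <= (\sum_v degree e v) ^ r ->
  exists k, 2 <= k /\ contains_cycle_blowup e k r.
Proof.
move=> e_sym e_irr r_gt0 l_gt0 /andP[n_gt0 n_le] hE.
pose a := complete_pair e (r := r).
have a_sym : symmetric a := complete_pair_sym e_sym.
have a_irr : irreflexive a := complete_pair_irr e_irr r_gt0.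
(* [M] is [8 * r ^ 2], the loss to conflicts inside the core, times [16 * (2 * (r * l)) ^ 3], which
   dominates the bound that [conflict_free_cycle] asks for. *)
pose M := 1024 * r ^ 5 * l ^ 3.
have M_gt0 : 0 < M by rewrite /M 2!muln_gt0 !expn_gt0 r_gt0 l_gt0.
have vol_ge : #|T| ^ r * (6 * M) ^ r <= \sum_X degree a X.
  exact: sum_degree_complete_pair.
have N_gt0 : 0 < #|T| ^ r by rewrite expn_gt0 n_gt0.
have vol_gt0 : 0 < \sum_X degree a X.
  by apply: leq_trans vol_ge; rewrite muln_gt0 N_gt0 expn_gt0 muln_gt0 M_gt0.
have [U U_ne coreU] := exists_dense_core a_sym a_irr vol_gt0.
pose inner X := #|[set Y in U | a X Y]|.
have inner_ge X : X \in U -> 2 * degree a X + (6 * M) ^ r <= 8 * inner X.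
  move=> /coreU; rewrite -/(inner X) card_ffun card_ord => h.
  rewrite -(leq_pmul2l N_gt0); move: h vol_ge; nia.
have inner_le X : inner X <= degree a X.
  by apply: subset_leq_card; apply/subsetP => Y; rewrite !inE => /andP[].
(* The vertex type is kept, and tuples outside the core become isolated. *)
pose b X Y := [&& a X Y, X \in U & Y \in U].
have b_sym : symmetric b by move=> X Y; rewrite /b a_sym [(X \in U) && _]andbC.
have degree_b X : X \in U -> degree b X = inner X.
  by move=> XU; apply: eq_card => Y; rewrite !inE /b XU andbC.
have ex_b : exists X Y, b X Y.
  have /set0Pn [X XU] := U_ne; exists X.
  have : 0 < degree b X.
    rewrite degree_b //; have := inner_ge X XU.
    have : 0 < (6 * M) ^ r by rewrite expn_gt0 muln_gt0 M_gt0.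
    lia.
  by rewrite card_gt0 => /set0Pn [Y]; rewrite inE; exists Y.
have conflicts Y u : #|[set X | b Y X && tuple_conflict X u]| * (16 * (r * l).+1 ^ 3)
    <= degree b Y.
  have [YU|YU] := boolP (Y \in U); last first.
    by rewrite (_ : [set X | _] = set0) ?cards0 //; apply/setP => X;
      rewrite !inE /b (negPf YU) andbF.
  rewrite degree_b //; set S := [set X | _].
  pose A := common_nbrs e Y.
  have S_le : #|A| * #|S| <= 2 * r ^ 2 * #|A| ^ r.
    apply: leq_trans (card_tuple_conflict A u); rewrite leq_mul2l.
    apply/orP; right; apply: subset_leq_card; apply/subsetP => X.
    by rewrite !in_set -complete_pairE => /andP[/and3P[aYX _ _] ->]; rewrite andbT.
  have degY : degree a Y = #|A| ^ r := degree_complete_pair e Y.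
  (* With [d = #|A| ^ r] the core bound gives [(6 * M) ^ r <= 8 * inner Y - 2 * d <= 6 * d]; the 6
     in the hypothesis makes this yield [M ^ r <= d]. *)
  have le_MA : M <= #|A|.
    have := inner_ge Y YU; have := inner_le Y; rewrite degY => h1 h2.
    rewrite leqNgt; apply/negP => lt_AM.
    have : #|A| ^ r < M ^ r by rewrite ltn_exp2r.
    have : 6 * M ^ r <= (6 * M) ^ r.
      by rewrite expnMn leq_mul2r -{1}(expn1 6) leq_exp2l // r_gt0 orbT.
    lia.
  have : M * #|S| <= 8 * r ^ 2 * inner Y.
    apply: (leq_trans (leq_mul le_MA (leqnn _))); apply: (leq_trans S_le).
    by rewrite -degY; have := inner_ge Y YU; nia.
  have -> : M = 8 * r ^ 2 * (128 * (r * l) ^ 3) by rewrite /M; ring.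
  rewrite -mulnA leq_pmul2l ?muln_gt0 ?expn_gt0 ?r_gt0 //.
  apply: leq_trans; rewrite mulnC leq_mul2r; apply/orP; right.
  rewrite -[128]/(16 * 2 ^ 3) -mulnA -expnMn leq_pmul2l // leq_exp2r //.
  by rewrite mul2n -addnn -addn1 leq_add2l muln_gt0 r_gt0.
have V_le : #|{: {ffun 'I_r -> T}}| <= 2 ^ (r * l).
  by rewrite card_ffun card_ord mulnC expnM leq_exp2r.
have rl_gt0 : 0 < r * l by rewrite muln_gt0 r_gt0.
have [k [c [k_ge2 sz_c cyc free]]] :=
  conflict_free_cycle rat b_sym conflicts rl_gt0 V_le ex_b (leqnn _).
exists k; split=> //; apply: (conflict_free_blowup e_sym k_ge2 sz_c _ free).
by apply: sub_cycle cyc => X Y /and3P[].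
Qed.

(** Each edge comes from an ordered adjacent pair; the factor 2 is given up. *)
Lemma edge_count_le (T : finType) (e : rel T) : edge_count e <= \sum_v degree e v.
Proof.
pose P := [set p : T * T | e p.1 p.2].
have -> : \sum_v degree e v = #|P|.
  rewrite -sum_bool_card -(pair_bigA _ (fun x y => (e x y : nat))) /=.
  by apply: eq_bigr => x _; rewrite sum_bool_card.
have sub : [set A : {set T} | [exists x, exists y, (A == [set x; y]) && e x y]]
   \subset [set [set p.1; p.2] | p in P].
  apply/subsetP => A; rewrite inE => /existsP [x /existsP [y /andP[/eqP -> exy]]].
  by apply/imsetP; exists (x, y); rewrite ?inE.
by rewrite (leq_trans (subset_leq_card sub)) // leq_imset_card.
Qed.

(** * The real estimate *)

Lemma INR_muln (m k : nat) : INR (m * k)%N = Rmult (INR m) (INR k).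
Proof. by rewrite -multE mult_INR. Qed.

Lemma INR_addn (m k : nat) : INR (m + k)%N = Rplus (INR m) (INR k).
Proof. by rewrite -plusE plus_INR. Qed.

Lemma INR_expn (m k : nat) : INR (m ^ k)%N = pow (INR m) k.
Proof. by elim: k => [|k IH]; rewrite ?expn0 // expnS INR_muln IH. Qed.

Lemma Rpower_pow_mult (x y : R) (k : nat) :
  pow (Rpower x y) k = Rpower x (Rmult y (INR k)).
Proof. by rewrite -Rpower_pow ?Rpower_mult //; apply: exp_pos. Qed.

(** Raising to the power [r] clears the fractional exponents, as (2 - 1/r) r = 2r - 1. *)
Lemma pow_Rpower_bound (c n lg : R) (r : nat) : (0 < r)%N ->
  Rlt 0 n -> Rlt 0 lg ->
  pow (Rmult (Rmult c (Rpower n (Rminus (INR 2) (Rdiv (INR 1) (INR r)))))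
             (Rpower lg (Rdiv (INR 7) (INR r)))) r =
  Rmult (Rmult (pow c r) (pow n (2 * r - 1)%N)) (pow lg 7).
Proof.
move=> r_gt0 n_gt0 lg_gt0.
have r0 : INR r <> (0 : R) by apply: not_0_INR; lia.
have inv_r : Rmult (Rinv (INR r)) (INR r) = (1 : R) by apply: Rinv_l.
have exponent : Rmult (Rminus (INR 2) (Rdiv (INR 1) (INR r))) (INR r) = INR (2 * r - 1)%N.
  have : INR (2 * r - 1 + 1)%N = INR (2 * r)%N by rewrite subnK // muln_gt0.
  rewrite INR_addn INR_muln => h; apply: (Rplus_eq_reg_r (INR 1)); rewrite h.
  by rewrite /Rdiv (erefl : INR 1 = (1 : R)); Lra.lra.
rewrite !Rpow_mult_distr !Rpower_pow_mult exponent !Rpower_pow //.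
have -> : Rmult (Rdiv (INR 7) (INR r)) (INR r) = INR 7 by rewrite /Rdiv Rmult_assoc inv_r Rmult_1_r.
by rewrite Rpower_pow.
Qed.

(** Rounding up adds at most 1, which is at most [log2 n] when [n >= 2]. *)
Lemma up_log2_bounds (n : nat) : (1 < n)%N ->
  Rle 1 (log2 (INR n)) /\ Rle (INR (up_log 2 n)) (Rmult 2 (log2 (INR n))).
Proof.
move=> n_gt1.
have INR2_gt1 : Rlt 1 (INR 2) by simpl; Lra.lra.
have ln2_gt0 : Rlt 0 (ln (INR 2)) by rewrite -ln_1; apply: ln_increasing; Lra.lra.
have n_gt0 : Rlt 0 (INR n) by apply: lt_0_INR; lia.
have log2_ge m : (2 ^ m <= n)%N -> Rle (INR m) (log2 (INR n)).
  move=> /ssrnat.leP/le_INR; rewrite INR_expn => le_mn.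
  apply: (Rmult_le_reg_r (ln (INR 2))) => //.
  rewrite /log2 /Rdiv Rmult_assoc Rinv_l; last by Lra.lra.
  rewrite Rmult_1_r -ln_pow; last by Lra.lra.
  have pow_gt0 : Rlt 0 (pow (INR 2) m) by apply: pow_lt; Lra.lra.
  case: le_mn => [lt_mn|->]; last by Lra.lra.
  by apply: Rlt_le; apply: ln_increasing.
have ge1 : Rle 1 (log2 (INR n)) by apply: (log2_ge 1%N).
split=> //.
have /andP[lt_n _] := up_log_bounds (isT : (1 < 2)%N) n_gt1.
have := log2_ge (up_log 2 n).-1 (ltnW lt_n).
have up_gt0 : (0 < up_log 2 n)%N by rewrite up_log_gt0.
rewrite -{2}(prednK up_gt0) S_INR; Lra.lra.
Qed.

Theorem theorem1p14 :
  forall r : nat, (0 < r)%N ->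
  exists c : R, Rlt (INR 0) c /\
    forall (T : finType) (e : rel T),
      symmetric e -> irreflexive e ->
      Rlt (Rmult (Rmult c (Rpower (INR #|T|) (Rminus (INR 2) (Rdiv (INR 1) (INR r)))))
                 (Rpower (log2 (INR #|T|)) (Rdiv (INR 7) (INR r))))
          (INR (edge_count e)) ->
      exists k : nat, (2 <= k)%N /\ contains_cycle_blowup e k r.
Proof.
move=> r r_gt0; pose K := (6 * (1024 * r ^ 5))%N.
have K_gt0 : (0 < K)%N by rewrite /K 2!muln_gt0 expn_gt0 r_gt0.
(* The 8 absorbs the cube in [l ^ 3 <= (2 * lg) ^ 3]. *)
pose c := INR (8 * K).
have c_ge1 : Rle 1 c.
  by apply: (le_INR 1); apply/ssrnat.leP; rewrite muln_gt0.
exists c; split; first by simpl; Lra.lra.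
move=> T e e_sym e_irr; set B := Rmult _ _ => ltB.
(* [Rpower] is an exponential, hence positive for every base; this settles graphs with at most one
   vertex, which have no edges. *)
have B_gt0 : Rlt 0 B.
  by apply: Rmult_lt_0_compat; [apply: Rmult_lt_0_compat; first Lra.lra|]; apply: exp_pos.
have leE : Rle (INR (edge_count e)) (INR (\sum_v degree e v)).
  by apply/le_INR/ssrnat.leP/edge_count_le.
have [n_le1|n_gt1] := leqP #|T| 1.
  have E0 : \sum_v degree e v = 0%N.
    apply: big1 => v _; apply/eqP; rewrite cards_eq0; apply/eqP/setP => u.
    by rewrite !inE (fintype_le1P n_le1 v u) e_irr.
  by rewrite E0 in leE; simpl in leE; Lra.lra.
have [lg_ge1 l_le] := up_log2_bounds n_gt1.
set n := INR #|T| in B ltB B_gt0 lg_ge1 l_le *; set l := up_log 2 #|T| in l_le.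
set lg := log2 n in B ltB B_gt0 lg_ge1 l_le.
have n_gt0 : Rlt 0 n by apply: lt_0_INR; lia.
have l_gt0 : (0 < l)%N by rewrite up_log_gt0.
apply: (@cycle_blowup_of_degree_sum T e r l) => //.
  by rewrite (ltnW n_gt1) up_logP.
apply/ssrnat.leP/INR_le; rewrite !INR_expn.
apply: (Rle_trans _ (pow B r)); last by apply: pow_incr; Lra.lra.
rewrite pow_Rpower_bound //; last by Lra.lra.
have -> : (6 * (1024 * r ^ 5 * l ^ 3) = K * l ^ 3)%N by rewrite /K !mulnA.
rewrite INR_muln INR_expn -/n INR_muln INR_expn.
have pn_gt0 : Rlt 0 (pow n (2 * r - 1)) by apply: pow_lt.
have c_le : Rle c (pow c r).
  rewrite -{1}(pow_1 c); apply: Rle_pow => //; exact/ssrnat.leP.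
(* As [lg >= 1], the third power coming from [l ^ 3] is dominated by the seventh. *)
have lg_le : Rle (pow lg 3) (pow lg 7) by apply: Rle_pow => //; apply/ssrnat.leP.
have l3_le : Rle (pow (INR l) 3) (Rmult 8 (pow lg 3)).
  have -> : Rmult 8 (pow lg 3) = pow (Rmult 2 lg) 3 by simpl; Lra.lra.
  by apply: pow_incr; split=> //; apply: pos_INR.
have K_ge0 := pos_INR K.
have lg3_ge0 : Rle 0 (pow lg 3) by apply: pow_le; Lra.lra.
have h1 : Rle (Rmult (INR K) (pow (INR l) 3)) (Rmult c (pow lg 3)).
  have -> : Rmult c (pow lg 3) = Rmult (INR K) (Rmult 8 (pow lg 3)).
    by rewrite /c INR_muln; simpl; Lra.lra.
  exact: Rmult_le_compat_l.
have h2 : Rle (Rmult c (pow lg 3)) (Rmult (pow c r) (pow lg 7)).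
  by apply: Rmult_le_compat => //; Lra.lra.
have -> : Rmult (Rmult (pow c r) (pow n (2 * r - 1))) (pow lg 7) =
  Rmult (pow n (2 * r - 1)) (Rmult (pow c r) (pow lg 7)) by Lra.lra.
apply: Rmult_le_compat_l; [exact: Rlt_le|exact: Rle_trans h1 h2].
Qed.
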